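(* Let $k$ be an integer with $1\le k\le N-1$ such that $\phi^{k-1}-\phi^k>\phi^k-\phi^{k+1}$, and let $F\in\tilde{\cal F}^{k-1}$. Then there exists a unique labeled atom ${\tt Z}\in\aleph_k^\bullet$ such that ${\tt N}^{out}_{\tt Z}(F)\neq\emptyset$. For this atom $F|_{\uparrow{\tt Z}}\in\tilde{\cal T}^\circ_{\tt Z}$. Moreover, for every $T\in\tilde{\cal T}^\circ_{\tt Z}$ there exists $G\in\tilde{\cal F}^{k-1}$ such that $G|_{\uparrow{\tt Z}}=T$.
   Context: $V$ is a directed graph without loops on a finite vertex set ${\tt N}$, $|{\tt N}|=N$; each arc $(i,j)$ has a real weight $v_{ij}$; $V$ is assumed to have at least one spanning tree. An (entering) forest is a directed graph in which at most one arc leaves each vertex and there are no directed cycles; its components are trees, the root of a tree being its unique vertex with no outgoing arc. All forests and trees are subgraphs of $V$. For a subgraph $G$ and ${\tt D}\subseteq{\tt N}$, $\Upsilon^G_{\tt D}=\sum_{i\in{\tt D},(i,j)\in G}v_{ij}$ (heads may lie outside ${\tt D}$), $\Upsilon^G=\Upsilon^G_{\tt N}$. ${\cal F}^j$: spanning forests of $V$ with exactly $j$ trees; $\phi^j=\min_{F\in{\cal F}^j}\Upsilon^F$ ($\phi^j=\infty$ if ${\cal F}^j=\emptyset$; $\phi^0=\infty$); $\tilde{\cal F}^j$: forests in ${\cal F}^j$ of weight $\phi^j$. $\mathfrak{A}_k$: algebra of subsets of ${\tt N}$ generated by the vertex sets of all trees of all forests in $\tilde{\cal F}^k$; $\aleph_k$: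 its atoms (nonempty elements ${\tt A}$ with ${\tt A}\cap{\tt B}\in\{\emptyset,{\tt A}\}$ for all ${\tt B}\in\mathfrak{A}_k$); $\aleph_k^\bullet$: labeled atoms (containing a root of some tree of some $F\in\tilde{\cal F}^k$). For ${\tt D}\subseteq{\tt N}$: ${\cal T}^\bullet_{\tt D}$ is the set of trees with vertex set ${\tt D}$; ${\cal T}^\circ_{\tt D}$ is the set of trees $T$ with $|{\tt V}T|=|{\tt D}|+1$, ${\tt D}\subset{\tt V}T$, and $T|_{\tt D}\in{\cal T}^\bullet_{\tt D}$; $\lambda^\circ_{\tt D}=\min_{T\in{\cal T}^\circ_{\tt D}}\Upsilon^T$ and $\tilde{\cal T}^\circ_{\tt D}=\{T\in{\cal T}^\circ_{\tt D}:\Upsilon^T=\lambda^\circ_{\tt D}\}$. $G|_{\tt D}$ is the induced subgraph on ${\tt D}$. ${\tt N}^{out}_{\tt D}(G)$ is the set of heads $j\notin{\tt D}$ of arcs $(i,j)\in G$ with $i\in{\tt D}$. The outgoing restriction $G|_{\uparrow{\tt D}}$ has as arcs exactly the arcs of $G$ with tail in ${\tt D}$ and vertex set ${\tt D}\cup{\tt N}^{out}_{\tt D}(G)$.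
   Formalization: The trees in ${\cal T}^\circ_{\tt D}$ are additionally required to have their root at the one vertex outside ${\tt D}$; without this, trees with a leaf pointing into ${\tt D}$ are admitted and the claim $F|_{\uparrow{\tt Z}}\in\tilde{\cal T}^\circ_{\tt Z}$ can fail. *)

(* Defs.v *)
From mathcomp Require Import all_boot all_order all_algebra.
From mathcomp Require Import constructive_ereal reals.

Set Implicit Arguments.
Unset Strict Implicit.
Unset Printing Implicit Defensive.

Import Order.TTheory GRing.Theory Num.Theory.

(* A directed graph is a pair (vertex set, arc set); the arc
   (i, j) goes from i (tail) to j (head).  Nothing forces the ends of an arc to
   be vertices: this is [wf_digraph], required of every subgraph below. *)
Definition digraph (T : finType) : Type := ({set T} * {set T * T})%type.

Definition verts (T : finType) (G : digraph T) : {set T} := G.1.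

Definition arcs (T : finType) (G : digraph T) : {set T * T} := G.2.

Definition wf_digraph (T : finType) (G : digraph T) : bool :=
  arcs G \subset setX (verts G) (verts G).

Definition loopless (T : finType) (G : digraph T) : bool :=
  [forall i, (i, i) \notin arcs G].

Definition subgraph (T : finType) (G H : digraph T) : bool :=
  [&& wf_digraph G, verts G \subset verts H & arcs G \subset arcs H].

Definition arc (T : finType) (G : digraph T) : rel T :=
  [rel i j | (i, j) \in arcs G].

Definition adjacent (T : finType) (G : digraph T) : rel T :=
  [rel i j | arc G i j || arc G j i].

Definition outdeg (T : finType) (G : digraph T) (i : T) : nat :=
  #|[set j | arc G i j]|.

Definition acyclic (T : finType) (G : digraph T) : bool :=
  [forall i, forall j, arc G i j ==> ~~ connect (arc G) j i].

Lemma acyclicP (T : finType) (G : digraph T) :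
  reflect (forall c : seq T, c != [::] -> ~~ cycle (arc G) c) (acyclic G).
Proof.
apply: (iffP idP) => [/forallP acG [//|x p] _ | nocyc].
  rewrite /cycle rcons_path; apply/negP => /andP[xp lx].
  have /forallP/(_ x)/implyP/(_ lx)/negP := acG (last x p); apply.
  by apply/connectP; exists p.
apply/forallP => i; apply/forallP => j; apply/implyP => ij.
apply/negP => /connectP[p jp ip].
have /negP := nocyc (j :: p) isT; apply.
by rewrite /cycle rcons_path jp -ip.
Qed.

(* [induced G D] is G|_D. *)
Definition induced (T : finType) (G : digraph T) (D : {set T}) : digraph T :=
  (verts G :&: D, [set a in arcs G | (a.1 \in D) && (a.2 \in D)]).

(* N^out_D(G). *)
Definition out_nbrs (T : finType) (D : {set T}) (G : digraph T) : {set T} :=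
  [set j | (j \notin D) && [exists i in D, arc G i j]].

(* The outgoing restriction of G to D: keeps the arcs of G with tail in D. *)
Definition out_restr (T : finType) (G : digraph T) (D : {set T}) : digraph T :=
  (D :|: out_nbrs D G, [set a in arcs G | a.1 \in D]).

Definition is_forest (T : finType) (G : digraph T) : bool :=
  [forall i, outdeg G i <= 1] && acyclic G.

(* The (weakly) connected components of G, as subgraphs. *)
Definition components (T : finType) (G : digraph T) : {set digraph T} :=
  [set induced G [set j | connect (adjacent G) i j] | i in verts G].

Definition is_tree (T : finType) (G : digraph T) : bool :=
  is_forest G && (#|components G| == 1).

(* A singleton when G is a tree. *)
Definition root_set (T : finType) (G : digraph T) : {set T} :=
  [set i in verts G | outdeg G i == 0].

(* Upsilon^G_D. *)
Definition weight_on (T : finType) (R : realType) (v : T -> T -> R)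
    (D : {set T}) (G : digraph T) : R :=
  (\sum_(a in arcs G | a.1 \in D) v a.1 a.2)%R.

Definition weight (T : finType) (R : realType) (v : T -> T -> R)
    (G : digraph T) : R := weight_on v [set: T] G.

(* The minimal weight over a family of graphs; +oo for the empty family. *)
Definition min_weight (T : finType) (R : realType) (v : T -> T -> R)
    (S : {set digraph T}) : \bar R :=
  (\big[Order.min/+oo]_(G in S) (weight v G)%:E)%E.

Definition minimizers (T : finType) (R : realType) (v : T -> T -> R)
    (S : {set digraph T}) : {set digraph T} :=
  [set G in S | (weight v G)%:E%E == min_weight v S].

(* F^j: the spanning forests of V with exactly j trees. *)
Definition forests (T : finType) (V : digraph T) (j : nat) :
    {set digraph T} :=
  [set F | [&& subgraph F V, verts F == verts V, is_forest F &
               #|components F| == j]].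

(* phi^j.  If V has a vertex, forests V 0 is empty and phi^0 is +oo. *)
Definition phi (T : finType) (R : realType) (v : T -> T -> R) (V : digraph T)
    (j : nat) : \bar R := min_weight v (forests V j).

Definition min_forests (T : finType) (R : realType) (v : T -> T -> R)
    (V : digraph T) (j : nat) : {set digraph T} := minimizers v (forests V j).

Definition is_algebra (T : finType) (A : {set {set T}}) : bool :=
  [&& set0 \in A, [forall X in A, ~: X \in A] &
      [forall X in A, forall Y in A, X :|: Y \in A]].

Definition gen_algebra (T : finType) (S : {set {set T}}) : {set {set T}} :=
  \bigcap_(A : {set {set T}} | is_algebra A && (S \subset A)) A.

Definition atoms (T : finType) (S : {set {set T}}) : {set {set T}} :=
  [set A in S | (A != set0) &&
     [forall B in S, (A :&: B == set0) || (A :&: B == A)]].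

(* The trees of the forests in tilde F^k. *)
Definition min_forest_trees (T : finType) (R : realType) (v : T -> T -> R)
    (V : digraph T) (k : nat) : {set digraph T} :=
  \bigcup_(F in min_forests v V k) components F.

(* The algebra A_k. *)
Definition forest_algebra (T : finType) (R : realType) (v : T -> T -> R)
    (V : digraph T) (k : nat) : {set {set T}} :=
  gen_algebra [set verts G | G in min_forest_trees v V k].

(* aleph_k^bullet. *)
Definition labeled_atoms (T : finType) (R : realType) (v : T -> T -> R)
    (V : digraph T) (k : nat) : {set {set T}} :=
  [set A in atoms (forest_algebra v V k) |
     [exists G in min_forest_trees v V k, root_set G :&: A != set0]].

(* T^bullet_D. *)
Definition trees_on (T : finType) (V : digraph T) (D : {set T}) :
    {set digraph T} :=
  [set G | [&& subgraph G V, is_tree G & verts G == D]].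

(* T^circ_D: a tree on D whose root sends one further arc out of D.  The last
   clause makes the vertex outside D the root; the others also allow it to be
   a leaf with an arc entering D, and such a tree is never an outgoing
   restriction to D. *)
Definition out_trees (T : finType) (V : digraph T) (D : {set T}) :
    {set digraph T} :=
  [set G | [&& subgraph G V, is_tree G, #|verts G| == #|D|.+1,
               D \subset verts G, induced G D \in trees_on V D &
               [disjoint root_set G & D]]].

Definition min_out_trees (T : finType) (R : realType) (v : T -> T -> R)
    (V : digraph T) (D : {set T}) : {set digraph T} :=
  minimizers v (out_trees V D).

(* Main.v *)
Require Import Defs.
From mathcomp Require Import all_boot all_order all_algebra.
From mathcomp Require Import boolp constructive_ereal reals.
From mathcomp Require Import zify lra.

Set Implicit Arguments.
Unset Strict Implicit.
Unset Printing Implicit Defensive.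

Import Order.TTheory GRing.Theory Num.Theory.

(** A forest is encoded as the map sending each vertex to the head of its
outgoing arc, roots being fixed points. If a set [D] is closed under one of two
forests, exchanging their arcs on [D] yields two forests of the same total
weight. With a strict gap at [k], exchanging on the trees of [g] shows that any
two minimal [k]-forests [f], [g] satisfy: each tree of [g] contains exactly one
root of [f], which lies in the same atom as the root of that tree; that no arc
of a minimal [k]-forest leaves a labeled atom; and that every labeled atom is a
tree of some minimal [k]-forest.

For a minimal [(k-1)]-forest [F] and a minimal [k]-forest [g], some tree of [g]
contains no root of [F]; giving [F] the arcs of [g] on this tree makes it a
minimal [k]-forest, so [F] is rooted in, and does not leave, every labeled atom
but one, [Z]. Choosing [g] with tree [Z], the forest equal to [F] on [Z] and to
[g] elsewhere is minimal with [k-1] trees, and its restriction to [Z] can be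
replaced by any tree on [Z] with one further outgoing arc. *)

(** * Forests as self-maps: roots, trees, gluing *)

Section FunctionalForests.
Variable T : finType.
Implicit Types (f g h : T -> T) (x y : T) (D : {set T}).

(* [#|T|] steps suffice to reach the root when [f] is acyclic. *)
Definition rt f x : T := iter #|T| f x.

(** Fixed points are the only cycles: every orbit stabilizes, and then within [#|T|] steps. *)
Definition acyc f : Prop := forall x, f (rt f x) = rt f x.

Lemma iter_fixed f n x : f x = x -> iter n f x = x.
Proof. by move=> fx; elim: n => //= n ->. Qed.

Lemma rt_fixed f x : f x = x -> rt f x = x.
Proof. exact: iter_fixed. Qed.

Lemma reach_rt f x n : f (iter n f x) = iter n f x -> f (rt f x) = rt f x.
Proof.
set y := iter n f x => fy; have xy : fconnect f x y by apply: fconnect_iter.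
have lt_y : findex f x y <= #|T|.
  by rewrite ltnW // (leq_trans (findex_max xy)) // max_card.
by rewrite /rt -(subnK lt_y) iterD iter_findex // iter_fixed.
Qed.

Lemma rt_step f x : acyc f -> rt f (f x) = rt f x.
Proof. by move=> acf; rewrite /rt -iterSr iterS acf. Qed.

Lemma rt_rt f x : acyc f -> rt f (rt f x) = rt f x.
Proof. by move=> acf; rewrite rt_fixed. Qed.

Lemma forest_ind f (Q : T -> Prop) : acyc f ->
  (forall x, f x = x -> Q x) -> (forall x, Q (f x) -> Q x) -> forall x, Q x.
Proof.
move=> acf Q0 QS x.
have: Q (rt f x) by apply: Q0.
by rewrite /rt; elim: #|T| => //= n IHn /QS.
Qed.

Lemma rt_closed f D x : {in D, forall y, f y \in D} -> x \in D -> rt f x \in D.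
Proof. by move=> fD xD; rewrite /rt; elim: #|T| => //= n /fD. Qed.

(** Converse of [forest_ind], by induction on the existence of an iterate that is a fixed point. *)
Lemma acyc_of_ind f : (forall Q : T -> Prop,
    (forall x, f x = x -> Q x) -> (forall x, Q (f x) -> Q x) -> forall x, Q x) ->
  acyc f.
Proof.
move=> ind x; suff [n] : exists n, f (iter n f x) = iter n f x by apply: reach_rt.
elim/ind: x => [x fx|x [n fn]]; first by exists 0.
by exists n.+1; rewrite iterSr.
Qed.

Lemma eq_acyc f g : f =1 g -> acyc f -> acyc g.
Proof.
move=> fg acf; apply: acyc_of_ind => Q Q0 QS; apply: (forest_ind acf) => x.
  by rewrite fg; apply: Q0.
by rewrite fg; apply: QS.
Qed.

Definition glue D f g x : T := if x \in D then f x else g x.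

Lemma glue_in D f g x : x \in D -> glue D f g x = f x.
Proof. by rewrite /glue => ->. Qed.

Lemma glue_out D f g x : x \notin D -> glue D f g x = g x.
Proof. by rewrite /glue => /negPf->. Qed.

Lemma glueC D f g : glue (~: D) f g =1 glue D g f.
Proof. by move=> x; rewrite /glue inE; case: (x \in D). Qed.

(** An orbit follows [g] until it enters [D]; from then on it follows [f] to a root. *)
Lemma acyc_glue D f g : acyc f -> acyc g -> {in D, forall x, f x \in D} ->
  acyc (glue D f g).
Proof.
move=> acf acg fD; apply: acyc_of_ind => Q Q0 QS.
have QD : forall x, x \in D -> Q x.
  apply: (forest_ind acf) => x => [fx|IH] xD; last first.
    by apply: QS; rewrite glue_in //; apply/IH/fD.
  by apply: Q0; rewrite glue_in.
apply: (forest_ind acg) => x gx; case: (boolP (x \in D)) => [/QD //|xD].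
  by apply: Q0; rewrite glue_out.
by apply: QS; rewrite glue_out.
Qed.

Lemma acyc_glueC D f g : acyc f -> acyc g ->
  {in ~: D, forall x, g x \in ~: D} -> acyc (glue D f g).
Proof. by move=> acf acg gD; apply: (eq_acyc (glueC D g f)); apply: acyc_glue. Qed.

Definition roots_in D f : {set T} := [set x in D | f x == x].

Definition nroots f : nat := #|roots_in setT f|.

Lemma nroots_split D f : nroots f = #|roots_in D f| + #|roots_in (~: D) f|.
Proof.
rewrite /nroots -(cardsID D); congr (_ + _); apply: eq_card => x;
by rewrite !inE andbC.
Qed.

Lemma nroots_glue D f g :
  nroots (glue D f g) = #|roots_in D f| + #|roots_in (~: D) g|.
Proof.
rewrite (nroots_split D); congr (_ + _); apply: eq_card => x; rewrite !inE /glue;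
by case: (x \in D).
Qed.

Definition tree_of f x : {set T} := [set y | rt f y == rt f x].

Lemma tree_of_refl f x : x \in tree_of f x.
Proof. by rewrite inE. Qed.

Lemma tree_of_closed f x : acyc f -> {in tree_of f x, forall y, f y \in tree_of f x}.
Proof. by move=> acf y; rewrite !inE rt_step. Qed.

Lemma tree_ofC_closed f x :
  acyc f -> {in ~: tree_of f x, forall y, f y \in ~: tree_of f x}.
Proof. by move=> acf y; rewrite !inE rt_step. Qed.

Lemma roots_tree_of f x : acyc f -> roots_in (tree_of f x) f = [set rt f x].
Proof.
move=> acf; apply/setP => y; rewrite !inE; 
apply/andP/eqP => [[/eqP <- /eqP /rt_fixed //]|->].
by rewrite rt_rt // acf.
Qed.

(** * Costs, minimal forests and exchange of arcs *)

Variables (R : realDomainType) (E : rel T) (c : T -> T -> R).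

Definition cost_on D f : R := (\sum_(x in D) c x (f x))%R.

Definition cost f : R := (\sum_x c x (f x))%R.

Lemma cost_split D f : cost f = (cost_on D f + cost_on (~: D) f)%R.
Proof.
rewrite /cost (bigID (mem D)) /=; congr (_ + _)%R.
by apply: eq_bigl => x; rewrite inE.
Qed.

Lemma cost_glue D f g : cost (glue D f g) = (cost_on D f + cost_on (~: D) g)%R.
Proof.
rewrite (cost_split D); congr (_ + _)%R; apply: eq_bigr => x; first by move/glue_in->.
by rewrite inE => /glue_out->.
Qed.

Lemma cost_glueD D f g :
  (cost (glue D f g) + cost (glue D g f) = cost f + cost g)%R.
Proof.
by rewrite !cost_glue (cost_split D f) (cost_split D g) addrACA [RHS]addrACA
  [(cost_on (~: D) g + _)%R]addrC.
Qed.

Definition forest_in f : Prop := acyc f /\ forall x, f x = x \/ E x (f x).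

Lemma forest_in_glue D f g : forest_in f -> forest_in g -> acyc (glue D f g) ->
  forest_in (glue D f g).
Proof. by move=> [_ Ef] [_ Eg] ac; split=> // x; rewrite /glue; case: ifP. Qed.

Definition min_forest n f : Prop := [/\ forest_in f, nroots f = n &
  forall g, forest_in g -> nroots g = n -> (cost f <= cost g)%R].

(** Gluing both ways keeps the total cost, and neither result can fall below the minimum for its
    number of roots; hence both attain it. *)
Lemma min_forest_exchange i j D f g :
  min_forest i f -> min_forest j g ->
  acyc (glue D f g) -> acyc (glue D g f) ->
  nroots (glue D f g) = i ->
  min_forest i (glue D f g) /\ min_forest j (glue D g f).
Proof.
move=> [Ff nf mf] [Fg ng mg] a1 a2 n1.
have n2 : nroots (glue D g f) = j.
  move: n1 nf ng; rewrite !nroots_glue (nroots_split D f) (nroots_split D g); lia.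
have F1 := forest_in_glue Ff Fg a1; have F2 := forest_in_glue Fg Ff a2.
have e := cost_glueD D f g.
have le1 := mf _ F1 n1; have le2 := mg _ F2 n2.
have e1 : cost (glue D f g) = cost f.
  apply/eqP; rewrite eq_le le1 andbT -(lerD2r (cost (glue D g f))) e lerD2l //.
have e2 : cost (glue D g f) = cost g by apply: (addrI (cost f)); rewrite -{1}e1.
by split; split=> // h Fh nh; rewrite ?e1 ?e2; [apply: mf|apply: mg].
Qed.

(** Here gluing on [D] interchanges the root counts, so the exchange is made on the complement of
    [D]. *)
Lemma min_forest_exchangeC i j D f g :
  min_forest i f -> min_forest j g ->
  acyc (glue D f g) -> acyc (glue D g f) ->
  nroots (glue D f g) = j ->
  min_forest j (glue D f g) /\ min_forest i (glue D g f).
Proof.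
move=> mf mg a1 a2 n1.
have [Ff nf cf] := mf; have [Fg ng cg] := mg.
have n2 : nroots (glue D g f) = i.
  move: n1 nf ng; rewrite !nroots_glue (nroots_split D f) (nroots_split D g); lia.
have := @min_forest_exchange i j (~: D) f g mf mg.
have -> : glue (~: D) f g = glue D g f by apply: funext (glueC D f g).
have -> : glue (~: D) g f = glue D f g by apply: funext (glueC D g f).
by move=> /(_ a2 a1 n2) [].
Qed.

(** Both glued forests follow [g] off [D], so only the costs on [D] are compared. *)
Lemma min_forest_reglue n D f s g :
  min_forest n (glue D f g) -> forest_in (glue D s g) ->
  #|roots_in D s| = #|roots_in D f| ->
  (cost_on D f <= cost_on D s)%R /\
  (cost_on D s = cost_on D f -> min_forest n (glue D s g)).
Proof.
move=> [_ nf mf] Fs card_s.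
have ns : nroots (glue D s g) = n by rewrite nroots_glue card_s -nroots_glue.
split; first by have := mf _ Fs ns; rewrite !cost_glue lerD2r.
by move=> e; split=> // h Fh nh; rewrite cost_glue e -cost_glue mf.
Qed.

(** * Consequences of a strict gap at [m.+1] *)

Section Gap.
Variable m : nat.
(** The gap is stated on individual forests, which keeps infinite values of [phi] out of the
    argument. *)
Hypothesis gap : forall f a b, min_forest m.+1 f ->
  forest_in a -> nroots a = m -> forest_in b -> nroots b = m.+2 ->
  (cost f + cost f < cost a + cost b)%R.

Let mf := min_forest m.+1.

Lemma mf_acyc f : mf f -> acyc f. Proof. by case=> [[]]. Qed.

(** If the tree [D] contained no root of [f], exchanging on [D] would give forests with [m] and
    [m.+2] roots whose total cost is twice the minimum, against the gap. *)
Lemma root_in_tree f g q : mf f -> mf g -> exists2 p, f p = p & rt g p = rt g q.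
Proof.
move=> Mf Mg; have [Ff nf _] := Mf; have [Fg ng _] := Mg.
have [acf acg] := (mf_acyc Mf, mf_acyc Mg).
set D := tree_of g q.
suff: roots_in D f != set0.
  by case/set0Pn => p; rewrite !inE => /andP[/eqP ? /eqP ?]; exists p.
apply/eqP => D0; have gD := tree_of_closed (x := q) acg.
have := @gap g (glue D f g) (glue D g f) Mg.
rewrite (cost_glueD D f g); have -> : cost f = cost g.
  by apply/eqP; rewrite eq_le; case: Mf Mg => _ _ hf [_ _ hg]; rewrite hf ?hg.
rewrite ltxx => lt_cost; suff: false by []; apply: lt_cost.
- by apply: forest_in_glue => //; apply: acyc_glueC => //; apply: tree_ofC_closed.
- move: ng; rewrite nroots_glue D0 cards0 (nroots_split D g) roots_tree_of //.
  by rewrite cards1; lia.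
- by apply: forest_in_glue => //; apply: acyc_glue.
move: nf; rewrite nroots_glue roots_tree_of // cards1 (nroots_split D f) D0 cards0; lia.
Qed.

(** Every tree of [g] receives a root of [f], and there are [m.+1] of each; a surjection between
    sets of equal size is injective. *)
Lemma root_in_tree_inj f g p p' : mf f -> mf g -> f p = p -> f p' = p' ->
  rt g p = rt g p' -> p = p'.
Proof.
move=> Mf Mg fp fp' e.
have /imset_injP inj : #|rt g @: roots_in setT f| == #|roots_in setT f|.
  rewrite eqn_leq leq_imset_card /=.
  rewrite -/(nroots f); have [_ -> _] := Mf; have [_ <- _] := Mg.
  apply/subset_leq_card/subsetP => q.
  rewrite !inE => /eqP gq; have [p1 fp1 gp1] := root_in_tree q Mf Mg.
  by apply/imsetP; exists p1; rewrite ?inE ?fp1 ?gp1 ?rt_fixed ?eqxx.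
by apply: inj => //; rewrite !inE; apply/eqP.
Qed.

Lemma mf_glue_tree f g q : mf f -> mf g ->
  mf (glue (tree_of g q) f g) /\ mf (glue (tree_of g q) g f).
Proof.
move=> Mf Mg; have [acf acg] := (mf_acyc Mf, mf_acyc Mg).
apply: min_forest_exchange => //.
- by apply: acyc_glueC => //; apply: tree_ofC_closed.
- by apply: acyc_glue => //; apply: tree_of_closed.
rewrite nroots_glue; have [_ <- _] := Mg; rewrite (nroots_split (tree_of g q) g).
congr (_ + _); rewrite roots_tree_of // cards1; apply/eqP/cards1P.
have [p fp gp] := root_in_tree q Mf Mg; exists p; apply/setP => y.
rewrite !inE; apply/andP/eqP => [[/eqP gy /eqP fy]|->]; last by rewrite gp fp !eqxx.
by apply: (root_in_tree_inj Mf Mg); rewrite // gp.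
Qed.

(** The relation of lying in one atom; [atom_of_trees] makes the link. *)
Definition sim x y : Prop := forall f, mf f -> rt f x = rt f y.

(** Glue [f] on the tree [D] of [g] at [p] with [g] elsewhere. For minimal [h], the tree of [rt g p]
    contains a root of this forest; off [D] it would be a second root of [g] in one tree of [h], so
    it is [p]. *)
Lemma sim_root f g p : mf f -> mf g -> f p = p -> sim p (rt g p).
Proof.
move=> Mf Mg fp h Mh; have acg := mf_acyc Mg.
have [M _] := mf_glue_tree p Mf Mg; set D := tree_of g p in M.
have [s] := root_in_tree (rt g p) M Mh.
have [sD|sD] := boolP (s \in D).
  rewrite glue_in // => fs; rewrite -(root_in_tree_inj Mf Mg fs fp) //.
  by apply/eqP; rewrite inE in sD.
rewrite glue_out // => gs /(root_in_tree_inj Mg Mh gs (acg p)) e.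
by move: sD; rewrite e inE rt_rt // eqxx.
Qed.

(** If [g] separated [h x] from [p], the forest equal to [h] on the tree [D] of [g] at [p] and to
    [g] elsewhere would carry [x] out of [D] for good, although the atom of [x] contains its root
    [a], which lies in [D]. *)
Lemma sim_closed f h p x : mf f -> f p = p -> mf h -> sim x p -> sim (h x) p.
Proof.
move=> Mf fp Mh xp g Mg; have [ach acg] := (mf_acyc Mh, mf_acyc Mg).
apply: contrapT => hx; set D := tree_of g p.
have [M _] := mf_glue_tree p Mh Mg; rewrite -/D in M.
have ap := sim_root Mf Mh fp; set a := rt h p in ap.
have xD : x \in D by rewrite inE (xp _ Mg).
have aD : a \in D by rewrite inE -(ap _ Mg).
have hD : h x \in ~: D by rewrite !inE; apply/eqP.
have e : rt (glue D h g) (h x) = rt (glue D h g) a.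
  by rewrite -(ap _ M) -(xp _ M) -[RHS](rt_step _ (mf_acyc M)) glue_in.
have : rt (glue D h g) (h x) \in ~: D.
  apply: rt_closed hD => y yD; rewrite glue_out; last by rewrite inE in yD.
  exact: tree_ofC_closed.
by rewrite e rt_fixed; [rewrite inE aD|rewrite glue_in // ach].
Qed.

(* Gluing two minimal forests intersects their trees through the root, so the
   atom is the smallest of these trees. *)
Lemma sim_tree f p : mf f -> f p = p ->
  exists2 g, mf g & forall x, rt g x = rt g p -> sim x p.
Proof.
move=> Mf fp; suff H n g : mf g -> #|tree_of g p| <= n ->
    exists2 g, mf g & forall x, rt g x = rt g p -> sim x p.
  exact: (H _ f Mf (leqnn _)).
elim: n g => [|n IHn] g Mg.
  by rewrite leqn0 cards_eq0 => /eqP /setP/(_ p); rewrite !inE eqxx.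
move=> card_g; have [H|] := pselect (forall x, rt g x = rt g p -> sim x p).
  by exists g.
move=> /existsNP[x /not_implyP[gx /existsNP[h /not_implyP[Mh hx]]]].
(* Here [h] separates [x] from [p]. Using [g] on [D] and [h] elsewhere keeps the tree of [p] inside
   that of [g] and expels [x]. *)
set D := tree_of h p; have [M _] := mf_glue_tree p Mg Mh; rewrite -/D in M.
set M' := glue _ _ _ in M.
have [acg ach] := (mf_acyc Mg, mf_acyc Mh).
have ap := sim_root Mf Mg fp; set a := rt g p in ap.
have aD : a \in D by rewrite inE -(ap _ Mh).
have Ma : M' a = a by rewrite /M' glue_in // acg.
have Mp : rt M' p = a by rewrite (ap _ M) rt_fixed.
have sD y : rt M' y = a -> y \in D.
  move=> My; apply: contraT => yD.
  have : rt M' y \in ~: D.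
    apply: rt_closed; last by rewrite inE.
    move=> z zD; rewrite /M' glue_out; last by rewrite inE in zD.
    exact: tree_ofC_closed.
  by rewrite My inE aD.
have sg : forall y, rt M' y = a -> rt g y = a.
  apply: (forest_ind (mf_acyc M)) => y My.
    by rewrite rt_fixed // => ->; rewrite rt_rt.
  move=> e; have yD := sD y e; move: My; rewrite rt_step; last exact: mf_acyc M.
  by rewrite /M' glue_in // rt_step // => ->.
apply: (IHn _ M); rewrite -ltnS; apply: leq_trans card_g; apply: proper_card.
apply/properP; split.
  by apply/subsetP => y; rewrite !inE Mp => /eqP/sg ->.
exists x; first by rewrite inE gx.
by rewrite inE Mp; apply/eqP => /sD; rewrite inE => /eqP.
Qed.



(** * Minimal forests with one tree fewer *)

Section FewerTrees.
Variable F : T -> T.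
Hypothesis MF : min_forest m F.

Let acF : acyc F. Proof. by case: MF => [[]]. Qed.

(** The [m] roots of [F] cannot meet all [m.+1] trees of [g]. *)
Lemma unrooted_tree g : mf g -> exists2 q, g q = q & roots_in (tree_of g q) F = set0.
Proof.
move=> Mg; have acg := mf_acyc Mg; have [_ ng _] := Mg; have [_ nF _] := MF.
have /subsetPn[q] : ~~ (roots_in setT g \subset rt g @: roots_in setT F).
  apply/negP => /subset_leq_card; rewrite -/(nroots g) ng leqNgt.
  by rewrite (leq_ltn_trans (leq_imset_card _ _)) // -/(nroots F) nF.
rewrite !inE => /eqP gq qF; exists q => //; apply/setP => x; rewrite !inE.
apply/negP => /andP[/eqP gx Fx]; case/imsetP: qF; exists x; first by rewrite !inE.
by rewrite gx rt_fixed.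
Qed.

Lemma unrooted_atom g : mf g -> exists q, [/\ exists2 f, mf f & f q = q,
  forall x, sim x q -> F x <> x &
  forall f p, mf f -> f p = p -> ~ sim p q -> forall x, sim x p -> sim (F x) p].
Proof.
move=> Mg; have [q gq qF] := unrooted_tree Mg; exists q.
have acg := mf_acyc Mg; set D := tree_of g q in qF.
have [MH _] : mf (glue D g F) /\ min_forest m (glue D F g).
  apply: min_forest_exchange => //.
  - by apply: acyc_glue => //; apply: tree_of_closed.
  - by apply: acyc_glueC => //; apply: tree_ofC_closed.
  rewrite nroots_glue roots_tree_of // cards1; have [_ <- _] := MF.
  by rewrite (nroots_split D F) qF cards0.
split; first by exists g.
  move=> x xq Fx; have : x \in roots_in D F by rewrite !inE Fx (xq _ Mg) !eqxx.
  by rewrite qF inE.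
(* The other labeled atoms lie off [D], where the new minimal forest agrees with [F]: a root [p] in
   [D] would be in the atom of [q] by [sim_root]. *)
move=> f p Mf fp pq x xp; have := sim_closed Mf fp MH xp.
rewrite glue_out // inE (xp _ Mg) (rt_fixed gq); apply/eqP => gp; apply: pq.
by rewrite -gp; apply: (sim_root Mf).
Qed.

(* If two arcs left the tree [Z] of [g], then redirecting only the vertices of
   [Z] that leave it through the first one would give a minimal forest with
   [m.+1] trees that has an arc out of the atom [Z]. *)
Lemma unique_exit f p : mf f -> f p = p -> (forall x, sim x p -> F x <> x) ->
  exists g, [/\ mf g, forall x, x \in tree_of g p <-> sim x p,
    min_forest m (glue (tree_of g p) F g) &
    {in tree_of g p &, forall x y, F x \notin tree_of g p -> F y \notin tree_of g p ->
      x = y}].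
Proof.
move=> Mf fp Fp; have [g Mg gp] := sim_tree Mf fp.
exists g; set Z := tree_of g p; have acg := mf_acyc Mg.
have ZP x : x \in Z <-> sim x p.
  by rewrite inE; split=> [/eqP/gp //|/(_ _ Mg) ->].
have FZ x : x \in Z -> F x != x by move/ZP/Fp/eqP.
have gZ : {in Z, forall y, g y \in Z} by apply: tree_of_closed.
have gZC : {in ~: Z, forall y, g y \in ~: Z} by apply: tree_ofC_closed.
have Z0 : roots_in Z F = set0.
  apply/setP => x; rewrite inE in_set0; case: (boolP (x \in Z)) => //= xZ.
  by rewrite (negPf (FZ _ xZ)).
have [_ MF'] : mf (glue Z g F) /\ min_forest m (glue Z F g).
  apply: min_forest_exchange => //.
  - exact: acyc_glue.
  - exact: acyc_glueC.
  rewrite nroots_glue roots_tree_of // cards1; have [_ <- _] := MF.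
  by rewrite (nroots_split Z F) Z0 cards0.
have Zg : roots_in Z g = [set rt g p] by apply: roots_tree_of.
clearbody Z; split=> // x y xZ yZ FxZ FyZ; apply: contrapT => xy.
(* The roots of [e] in [Z] are the exits of [F]: [rt e z] is the vertex through which the path of
   [F] from [z] leaves [Z]. *)
pose e := glue [set z in Z | F z \in Z] F id.
have ace : acyc e by apply: acyc_glueC => // z; rewrite !inE.
have eF z : z \in Z -> F z \in Z -> e z = F z.
  by move=> zZ FzZ; rewrite /e glue_in // inE zZ.
have e_exit z : F z \notin Z -> rt e z = z.
  by move=> FzZ; rewrite rt_fixed // /e glue_out // inE (negPf FzZ) andbF.
(* The root of [g] in [Z] leaves through one exit only; up to swapping [x] and [y], this is not [x],
   which keeps that root out of [B]. *)
wlog qx : x y xZ yZ FxZ FyZ xy / rt e (rt g p) <> x.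
  move=> H; have [/eqP qx|/eqP qx] := boolP (rt e (rt g p) == x); last exact: (H x y).
  by apply: (H y x) => // [/esym//|]; rewrite qx.
pose B := [set z in Z | rt e z == x].
have BZ : B \subset Z by apply/subsetP => z; rewrite inE => /andP[].
have FB z : z \in B -> F z \in B \/ F z \notin Z.
  rewrite inE => /andP[zZ /eqP ez]; have [FzZ|] := boolP (F z \in Z); [left|by right].
  by rewrite inE FzZ -(eF _ zZ FzZ) rt_step // ez eqxx.
have FBC z : z \in Z -> z \notin B -> F z \notin B.
  move=> zZ zB; apply: contra zB; rewrite !(inE, zZ) => /andP[FzZ].
  by rewrite -(eF _ zZ FzZ) rt_step.
set F' := glue Z F g in MF'.
have acF' : acyc F' by case: MF' => [[]].
have acP : acyc (glue B F' g).
  (* Off [Z] the maps [F'] and [g] agree, so gluing may be done on [B :|: ~: Z], which [F'] does not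
     leave. *)
  apply: (@eq_acyc (glue (B :|: ~: Z) F' g)).
    move=> z; rewrite /glue in_setU in_setC; case: (boolP (z \in B)) => //= zB.
    by case: (boolP (z \in Z)) => //= zZ; rewrite /F' glue_out.
  apply: acyc_glue => // z; rewrite !in_setU !in_setC /F' => /orP[zB|zZ].
    by rewrite (glue_in _ _ (subsetP BZ _ zB)); case: (FB _ zB) => ->; rewrite ?orbT.
  by have := gZC z; rewrite !in_setC glue_out // => ->; rewrite ?orbT.
have acP' : acyc (glue B g F').
  apply: acyc_glueC => // z; rewrite !in_setC /F' => zB.
  have [zZ|zZ] := boolP (z \in Z); first by rewrite (glue_in _ _ zZ) FBC.
  rewrite (glue_out _ _ zZ); apply: contra (subsetP BZ _) _.
  by have := gZC z; rewrite !in_setC => ->.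
have nP : nroots (glue B F' g) = m.+1.
  rewrite nroots_glue; have [_ <- _] := Mg; rewrite (nroots_split B g).
  congr (_ + _); transitivity 0; [|symmetry]; apply/eqP; rewrite cards_eq0;
    apply/eqP/setP => z; rewrite inE in_set0; apply/negP => /andP[zB /eqP].
    by rewrite /F' (glue_in _ _ (subsetP BZ _ zB)); apply/eqP/FZ/(subsetP BZ).
  move=> gz; have zZ := subsetP BZ _ zB.
  have : z \in roots_in Z g by rewrite inE zZ gz eqxx.
  rewrite Zg inE => /eqP ez.
  by move: zB; rewrite inE ez => /andP[_ /eqP].
have [MP _] := min_forest_exchangeC MF' Mg acP acP' nP.
have xB : x \in B by rewrite inE xZ e_exit ?eqxx.
(* The glued forest is minimal with [m.+1] trees, yet it still sends [x] out of the atom [Z]. *)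
have /ZP := sim_closed Mf fp MP ((ZP _).1 xZ).
by rewrite glue_in // /F' glue_in //; apply/negP.
Qed.
End FewerTrees.
End Gap.
End FunctionalForests.

(* [arc] alone is now [path.arc]. *)
Local Notation arc := Defs.arc.

(** * Atoms of a generated algebra of sets *)

Section GeneratedAlgebra.
Variables (T : finType) (S : {set {set T}}).

Definition atom_of (x : T) : {set T} :=
  [set y | [forall B in S, (x \in B) == (y \in B)]].

Lemma atom_ofP x y :
  reflect {in S, forall B : {set T}, (x \in B) = (y \in B)} (y \in atom_of x).
Proof. by rewrite inE; apply: (iffP forall_inP) => H B BS; apply/eqP/H. Qed.

Lemma atom_of_refl x : x \in atom_of x.
Proof. exact/atom_ofP. Qed.

(** The unions of classes [atom_of x] form an algebra containing [S], hence the generated one. *)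
Lemma mem_gen_algebra (A : {set T}) x y :
  A \in gen_algebra S -> y \in atom_of x -> (x \in A) = (y \in A).
Proof.
pose saturated :=
  [set X : {set T} | [forall x, forall y in atom_of x, (x \in X) == (y \in X)]].
have satP X : X \in saturated <-> forall x y, y \in atom_of x -> (x \in X) = (y \in X).
  rewrite inE; split=> [/forallP H a b ab|H].
    by apply/eqP; have /forall_inP := H a; apply.
  by apply/forallP => a; apply/forall_inP => b /H/eqP.
move=> /bigcapP/(_ saturated)-AS xy; suff: A \in saturated by move/satP/(_ _ _ xy).
apply: AS; apply/andP; split; first apply/and3P; first split.
- by apply/satP => a b _; rewrite !inE.
- by apply/forall_inP => X /satP sX; apply/satP => a b /sX; rewrite !inE => ->.
- apply/forall_inP => X /satP sX; apply/forall_inP => Y /satP sY; apply/satP => a b ab.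
  by rewrite !inE (sX _ _ ab) (sY _ _ ab).
by apply/subsetP => B BS; apply/satP => a b /atom_ofP; apply.
Qed.

(** The class is a finite intersection: for each generator, take it or its complement, whichever
    contains [x]. *)
Lemma atom_of_gen_algebra x : atom_of x \in gen_algebra S.
Proof.
apply/bigcapP => A /andP[/and3P[A0 /forall_inP AC /forall_inP AU] /subsetP SA].
have -> : atom_of x = \bigcap_(B in S) (if x \in B then B else ~: B).
  apply/setP => y; apply/atom_ofP/bigcapP => H B BS; have := H B BS.
    by case: ifP; rewrite ?inE => _ <-.
  by case: ifP; rewrite ?inE => _; [move->|move/negPf->].
apply: (big_ind (fun X => X \in A)) => [|X Y XA YA|B BS]; first by rewrite -setC0 AC.
  rewrite -[X :&: Y]setCK setCI AC //.
  by have /forall_inP := AU _ (AC _ XA); apply; apply: AC.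
by case: ifP => _; rewrite ?AC ?SA.
Qed.

Lemma atomsP A : A \in atoms (gen_algebra S) <-> exists x, A = atom_of x.
Proof.
rewrite inE; split=> [/and3P[AS /set0Pn[x xA] /forall_inP minA]|[x ->]].
  exists x; have := minA _ (atom_of_gen_algebra x).
  have sub : atom_of x \subset A by apply/subsetP => y /(mem_gen_algebra AS) <-.
  rewrite (setIidPr sub) => /orP[/eqP/setP/(_ x)|/eqP //].
  by rewrite atom_of_refl inE.
rewrite atom_of_gen_algebra /=; apply/andP; split.
  by apply/set0Pn; exists x; apply: atom_of_refl.
apply/forall_inP => B BS; have [xB|xB] := boolP (x \in B); apply/orP; [right|left].
  by apply/eqP/setIidPl/subsetP => y /(mem_gen_algebra BS) <-.
apply/eqP/setP => y; rewrite in_setI in_set0; apply/negP => /andP[/(mem_gen_algebra BS) e].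
by apply/negP; rewrite -e.
Qed.

End GeneratedAlgebra.

(** * Correspondence between digraphs and self-maps *)

Section FunctionGraphs.
Variable T : finType.
Implicit Types (f g : T -> T) (x y : T) (D W : {set T}) (G : digraph T).

Definition graph W f : digraph T :=
  (W, [set a | (a.2 == f a.1) && (a.1 != a.2)]).

(** The default [x] makes a vertex without outgoing arc a fixed point. *)
Definition fun_of G x : T := odflt x [pick y | arc G x y].

Lemma arc_graph W f x y : arc (graph W f) x y = (y == f x) && (x != y).
Proof. by rewrite /arc /= inE. Qed.

Lemma eq_graph W f g : f =1 g -> graph W f = graph W g.
Proof. by move=> fg; congr pair; apply/setP => a; rewrite !inE fg. Qed.

Lemma fconnect_graph W f x y : fconnect f x y -> connect (arc (graph W f)) x y.
Proof.
apply: connect_sub => a b /eqP <-; have [->|fa] := eqVneq (f a) a; first exact: connect0.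
by apply: connect1; rewrite arc_graph eqxx eq_sym.
Qed.

(** Induction towards the root: if [f x] returns to [x], then [f (f x)] returns to [f x], so [f x]
    is fixed and reaches only itself. *)
Lemma acyc_no_return f x : acyc f -> fconnect f (f x) x -> f x = x.
Proof.
move=> acf; move: x; apply: (forest_ind acf) => // x IH fx.
rewrite fconnect_eqVf in fx; case/orP: fx => [/eqP //|fx].
have {}IH := IH (connect_trans fx (fconnect1 f x)).
by rewrite -[RHS](iter_findex fx) iter_fixed // IH.
Qed.

Lemma is_forest_graph W f : is_forest (graph W f) <-> acyc f.
Proof.
split=> [/andP[_ /forallP acG] x|acf].
  (* The orbit of [x] is eventually periodic and [y] recurs in it; acyclicity forces [y] to be
     fixed. *)
  have /trajectP[i lti ei] := looping_order f x; set y := iter i f x in ei.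
  have fyy : fconnect f (f y) y.
    rewrite -[X in fconnect f _ X]ei -(subnK lti) iterD.
    exact: fconnect_iter.
  suff fy : f y = y by apply: (@reach_rt _ _ _ i).
  apply/eqP; apply: contraT => fy.
  have /forallP/(_ (f y))/implyP := acG y; rewrite arc_graph eqxx eq_sym fy /=.
  move=> /(_ isT)/negP[]; apply: fconnect_graph.
  exact: fyy.
apply/andP; split.
  apply/forallP => x; rewrite /outdeg -(cards1 (f x)); apply/subset_leq_card/subsetP => y.
  by rewrite !inE arc_graph => /andP[].
apply/forallP => x; apply/forallP => y; apply/implyP; rewrite arc_graph => /andP[/eqP ->].
apply: contra => fxx; rewrite eq_sym; apply/eqP/acyc_no_return => //.
apply: connect_sub fxx => a b; rewrite arc_graph => /andP[/eqP -> _].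
exact: fconnect1.
Qed.

Lemma arc_fun_of G x y : is_forest G -> arc G x y = (y == fun_of G x) && (x != y).
Proof.
case/andP => /forallP/(_ x) dG /forallP acG; rewrite /fun_of; case: pickP => /= [z xz|xG].
  have E : [set y | arc G x y] = [set z].
    by apply/eqP; rewrite eq_sym eqEcard sub1set inE xz cards1.
  have -> : arc G x y = (y == z) by move/setP/(_ y): E; rewrite !inE.
  have [->|//] := eqVneq y z; apply/esym; apply: contraTneq xz => <-.
  by apply/negP => xx; have /forallP/(_ x)/implyP/(_ xx) := acG x; rewrite connect0.
by rewrite xG; case: eqVneq => //= ->; rewrite eqxx.
Qed.

Lemma graph_fun_of G : is_forest G -> graph (verts G) (fun_of G) = G.
Proof.
case: G => W A FG; congr pair; apply/setP => -[x y].
by rewrite inE /= -(arc_fun_of x y FG).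
Qed.

Lemma wf_graphP W f : reflect (forall x, f x <> x -> x \in W /\ f x \in W)
  (wf_digraph (graph W f)).
Proof.
apply: (iffP subsetP) => [wf x fx|wf [x y]].
  have := wf (x, f x); rewrite !inE /= eqxx eq_sym; move/eqP: fx => -> /(_ isT).
  by move/andP.
by rewrite !inE /= => /andP[/eqP -> /eqP /nesym /wf[-> ->]].
Qed.

Lemma wf_graph_closed W f : wf_digraph (graph W f) -> {in W, forall x, f x \in W}.
Proof. by move=> /wf_graphP wf x xW; case: (pselect (f x = x)) => [->|/wf[]]. Qed.

(** Adjacent vertices have the same root, and following arcs joins each vertex to its root. *)
Lemma connect_graph W f x y : acyc f ->
  connect (adjacent (graph W f)) x y = (rt f x == rt f y).
Proof.
move=> acf; set e := adjacent _.
have sym_e : connect_sym e.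
  by apply: sym_connect_sym => a b; rewrite /e /adjacent /= orbC.
have to_rt : forall z, connect e z (rt f z).
  apply: (forest_ind acf) => z; first by move/rt_fixed->; apply: connect0.
  rewrite rt_step //; have [->//|fz] := eqVneq (f z) z.
  by apply: connect_trans; apply: connect1; rewrite /e /adjacent /= arc_graph eqxx
    eq_sym fz.
apply/idP/eqP => [/connectP[p ep ->]|exy].
  elim: p x ep => //= z p IHp x /andP[xz /IHp <-].
  move: xz; rewrite /e /adjacent /= !arc_graph.
  by case/orP => /andP[/eqP -> _]; rewrite rt_step.
by apply: connect_trans (to_rt x) _; rewrite exy sym_e.
Qed.

Lemma component_graph W f x : acyc f ->
  [set y | connect (adjacent (graph W f)) x y] = tree_of f x.
Proof. by move=> acf; apply/setP => y; rewrite !inE connect_graph // eq_sym. Qed.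

Lemma components_graph W f : acyc f ->
  components (graph W f) = [set induced (graph W f) (tree_of f x) | x in W].
Proof. by move=> acf; apply: eq_imset => x; rewrite component_graph. Qed.

Lemma card_components W f : acyc f -> wf_digraph (graph W f) ->
  #|components (graph W f)| = #|roots_in W f|.
Proof.
move=> acf wf; rewrite components_graph //.
(* Naming each component by its root makes the indexing injective. *)
have -> : [set induced (graph W f) (tree_of f x) | x in W] =
    [set induced (graph W f) (tree_of f x) | x in roots_in W f].
  apply/setP => C; apply/imsetP/imsetP => -[x xW ->]; last first.
    by exists x => //; move: xW; rewrite inE => /andP[].
  exists (rt f x); last by congr induced; apply/setP => y; rewrite !inE rt_rt.
  by rewrite inE acf eqxx andbT rt_closed //; apply: wf_graph_closed.
apply: card_in_imset => x y; rewrite !inE => /andP[xW /eqP fx] /andP[yW /eqP fy].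
case=> /setP/(_ x); rewrite !inE xW eqxx /= => /esym/eqP.
by rewrite !rt_fixed.
Qed.

Lemma is_tree_graph W f : wf_digraph (graph W f) ->
  is_tree (graph W f) <-> acyc f /\ #|roots_in W f| = 1.
Proof.
move=> wf; split=> [/andP[/is_forest_graph acf]|[acf card1]].
  by rewrite card_components // => /eqP.
by apply/andP; split; [apply/is_forest_graph|rewrite card_components ?card1].
Qed.

Lemma outdeg_graph W f x : (outdeg (graph W f) x == 0) = (f x == x).
Proof.
rewrite /outdeg cards_eq0; apply/eqP/eqP => [/setP/(_ (f x))|fx].
  by rewrite !inE arc_graph eqxx /= eq_sym => /negbFE/eqP.
by apply/setP => y; rewrite !inE arc_graph fx eq_sym andbN.
Qed.

(** An arc leaving [D] is lost, so its tail becomes a root. *)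
Lemma induced_graph W f D : D \subset W ->
  induced (graph W f) D = graph D (glue [set x in D | f x \in D] f id).
Proof.
move=> /setIidPr DW; rewrite /induced /= DW; congr pair; apply/setP => -[x y].
rewrite /glue !inE /=; case: (boolP (x \in D)) => xD; case: (boolP (f x \in D)) => fxD /=;
  rewrite ?andbF ?andbT ?(eq_sym y x) ?andbN //.
  by have [->|] := eqVneq y (f x); rewrite ?fxD ?andbT.
by have [->|] := eqVneq y (f x); rewrite ?(negPf fxD) ?andbF.
Qed.

(** * Weights, minima and the forests of [V] *)

Variables (R : realType) (v : T -> T -> R).

(** Roots must cost nothing, whatever [v] is on the diagonal. *)
Definition arc_cost x y : R := if y == x then 0%R else v x y.

Lemma weight_on_graph W f D : weight_on v D (graph W f) = cost_on arc_cost D f.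
Proof.
rewrite /weight_on /cost_on.
rewrite (eq_bigl (fun a => (a.1 \in D) && ((a.2 == f a.1) && (a.1 != a.2)))); last first.
  by move=> a; rewrite /= inE andbC.
rewrite -(pair_big_dep (fun x => x \in D) (fun x y => (y == f x) && (x != y)) v) /=.
apply: eq_bigr => x _; rewrite big_mkcondr big_pred1_eq /arc_cost eq_sym.
by case: eqP.
Qed.

Lemma weight_graph W f : weight v (graph W f) = cost arc_cost f.
Proof. by rewrite /weight weight_on_graph; apply: eq_bigl => x; rewrite inE. Qed.

Lemma min_weight_le (S : {set digraph T}) G : G \in S ->
  (min_weight v S <= (weight v G)%:E)%E.
Proof.
move=> GS; rewrite /min_weight.
exact: (@bigmin_le_cond _ _ _ +oo%E G (mem S) (fun G => (weight v G)%:E)).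
Qed.

Lemma minimizersP (S : {set digraph T}) G : G \in minimizers v S <->
  G \in S /\ forall H, H \in S -> (weight v G <= weight v H)%R.
Proof.
rewrite inE; split=> [/andP[GS /eqP eG]|[GS minG]].
  by split=> // H HS; rewrite -lee_fin eG; apply: min_weight_le.
rewrite GS eq_le /=; apply/andP; split; last exact: min_weight_le.
by apply/bigmin_geP; split=> [|H HS]; rewrite ?leey // lee_fin minG.
Qed.

Variable V : digraph T.
Hypothesis V_spans : verts V = [set: T].

Lemma subgraph_graph W f : subgraph (graph W f) V <->
  wf_digraph (graph W f) /\ forall x, f x = x \/ arc V x (f x).
Proof.
rewrite /subgraph V_spans subsetT /=; split=> [/andP[-> /subsetP fV]|[-> fV]] /=.
  split=> // x; have [|fx] := eqVneq (f x) x; [by left|right].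
  by apply: fV; rewrite inE /= eqxx eq_sym.
apply/subsetP => -[x y]; rewrite inE /= => /andP[/eqP -> xf].
by case: (fV x) => // fx; rewrite fx eqxx in xf.
Qed.

Lemma forestsP j G : G \in forests V j <->
  exists f, [/\ G = graph [set: T] f, forest_in (arc V) f & nroots f = j].
Proof.
rewrite inE V_spans; split=> [/and4P[sGV /eqP vG FG /eqP cG]|[f [-> [acf fV] nf]]].
  move: (graph_fun_of FG) sGV cG (FG); rewrite vG; set f := fun_of G => <-.
  move=> /subgraph_graph[wf fV] cG /is_forest_graph acf.
  by exists f; split=> //; rewrite -cG card_components.
have wf : wf_digraph (graph [set: T] f) by apply/wf_graphP => x; rewrite !inE.
apply/and4P; split=> //; first exact/subgraph_graph.
  exact/is_forest_graph.
by rewrite card_components // -nf.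
Qed.

Lemma min_forestsP j G : G \in min_forests v V j <->
  exists2 f, G = graph [set: T] f & min_forest (arc V) arc_cost j f.
Proof.
split=> [/minimizersP[/forestsP[f [-> Ff nf]] minf]|[f -> [Ff nf minf]]].
  exists f => //; split=> // g Fg ng; rewrite -!(weight_graph setT); apply: minf.
  by apply/forestsP; exists g.
apply/minimizersP; split; first by apply/forestsP; exists f.
by move=> H /forestsP[g [-> Fg ng]]; rewrite !weight_graph minf.
Qed.

Lemma gap_min_forest k : 0 < k ->
  (phi v V (k - 1) - phi v V k > phi v V k - phi v V (k + 1))%E ->
  forall f a b, min_forest (arc V) arc_cost k f ->
    forest_in (arc V) a -> nroots a = k - 1 ->
    forest_in (arc V) b -> nroots b = k + 1 ->
  (cost arc_cost f + cost arc_cost f < cost arc_cost a + cost arc_cost b)%R.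
Proof.
move=> k_gt0 gap f a b [Ff nf minf] Fa na Fb nb.
have Epk : phi v V k = (cost arc_cost f)%:E%E.
  have : graph setT f \in min_forests v V k by apply/min_forestsP; exists f.
  by rewrite inE weight_graph => /andP[_ /eqP].
have le_a : (phi v V (k - 1) <= (cost arc_cost a)%:E)%E.
  rewrite -(weight_graph setT); apply: min_weight_le.
  by apply/forestsP; exists a.
have le_b : (phi v V (k + 1) <= (cost arc_cost b)%:E)%E.
  rewrite -(weight_graph setT); apply: min_weight_le.
  by apply/forestsP; exists b.
move: gap; rewrite Epk; move: le_a le_b.
(* An infinite value would contradict [le_a], [le_b] or the gap. *)
case: (phi v V (k - 1)) => [pa| |]; case: (phi v V (k + 1)) => [pb| |] //=.
rewrite !lee_fin -!EFinB lte_fin => ? ? ?; lra.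
Qed.

Lemma min_forest_exists k :
  (phi v V (k - 1) - phi v V k > phi v V k - phi v V (k + 1))%E ->
  exists f, min_forest (arc V) arc_cost k f.
Proof.
have [V0|[G GV]] := set_0Vmem (forests V k).
  (* The left-hand difference is then [-oo], even in the case [+oo - +oo], so it cannot be the
     larger one. *)
  have -> : phi v V k = +oo%E by rewrite /phi /min_weight V0 big_set0.
  by case: (phi v V (k - 1)) (phi v V (k + 1)) => [a| |] [b| |].
move=> _; pose w G := (weight v G)%:E%E.
have [H HV eH] := @eq_bigmin _ _ _ +oo%E G (mem (forests V k)) w GV (fun _ _ => leey _).
have /min_forestsP[f _ Mf] : H \in min_forests v V k.
  rewrite inE; apply/andP; split; [exact: HV|exact/eqP/esym/eH].
by exists f.
Qed.

Lemma min_forest_treesP k G : G \in min_forest_trees v V k <->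
  exists f x, min_forest (arc V) arc_cost k f /\ G = induced (graph setT f) (tree_of f x).
Proof.
split=> [/bigcupP[F /min_forestsP[f -> Mf]]|[f [x [Mf ->]]]].
  have acf : acyc f by case: Mf => -[].
  by rewrite components_graph // => /imsetP[x _ ->]; exists f, x.
apply/bigcupP; exists (graph setT f); first by apply/min_forestsP; exists f.
have acf : acyc f by case: Mf => -[].
by rewrite components_graph //; apply: imset_f.
Qed.

(** * Labeled atoms in terms of minimal forests *)

Local Notation sim := (sim (arc V) arc_cost).

Lemma atom_of_trees k x y :
  y \in atom_of [set verts G | G in min_forest_trees v V k.+1] x <-> sim k y x.
Proof.
split=> [/atom_ofP xy f Mf|xy].
  apply/eqP; have := xy (tree_of f x).
  rewrite !inE eqxx => <- //; apply/imsetP.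
  exists (induced (graph setT f) (tree_of f x)).
    by apply/min_forest_treesP; exists f, x.
  by rewrite /induced /= setTI.
apply/atom_ofP => B /imsetP[G /min_forest_treesP[f [z [Mf ->]]] ->].
by rewrite !inE (xy f Mf).
Qed.

Lemma labeled_atomsP k A : A \in labeled_atoms v V k.+1 <->
  exists f p, [/\ min_forest (arc V) arc_cost k.+1 f, f p = p &
    forall x, x \in A <-> sim k x p].
Proof.
rewrite inE; split=> [/andP[/atomsP[x ->] /exists_inP[G]]|[f [p [Mf fp AP]]]].
  move=> /min_forest_treesP[f [y [Mf ->]]] /set0Pn[p]; rewrite in_setI => /andP[].
  have acf : acyc f by case: Mf => -[].
  rewrite induced_graph ?subsetT // inE outdeg_graph => /andP[/= py].
  rewrite glue_in; last by rewrite inE py tree_of_closed.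
  move=> /eqP fp pA; exists f, p; split=> // z.
  have {}pA := (atom_of_trees _ _ _).1 pA.
  by rewrite atom_of_trees; split=> H h Mh; rewrite H // pA.
have EA : A = atom_of [set verts G | G in min_forest_trees v V k.+1] p.
  by apply/setP => x; apply/idP/idP; rewrite AP atom_of_trees.
apply/andP; split; first by apply/atomsP; exists p.
apply/exists_inP; exists (induced (graph setT f) (tree_of f p)).
  by apply/min_forest_treesP; exists f, p.
apply/set0Pn; exists p; rewrite in_setI; apply/andP; split; last by rewrite EA atom_of_refl.
have acf : acyc f by case: Mf => -[].
rewrite induced_graph ?subsetT // inE outdeg_graph tree_of_refl.
by rewrite glue_in ?fp ?eqxx // inE fp tree_of_refl.
Qed.

(** * Outgoing restrictions and trees with one outgoing arc *)

Lemma out_nbrs_graph W f D x : (x \in out_nbrs D (graph W f)) =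
  (x \notin D) && (x \in f @: D).
Proof.
rewrite inE; case: (boolP (x \in D)) => //= xD.
apply/exists_inP/imsetP => -[y yD].
  by rewrite arc_graph => /andP[/eqP -> _]; exists y.
by move=> xy; exists y => //; rewrite arc_graph xy eqxx -xy (memPn xD).
Qed.

Lemma out_nbrs_graphP W f D :
  reflect (exists2 x, x \in D & f x \notin D) (out_nbrs D (graph W f) != set0).
Proof.
apply: (iffP (set0Pn _)) => -[x]; rewrite ?out_nbrs_graph.
  by case/andP=> xD /imsetP[y yD e]; exists y; rewrite -?e.
by move=> xD fx; exists (f x); rewrite out_nbrs_graph fx imset_f.
Qed.

Lemma out_restr_graph W f D : out_restr (graph W f) D =
  graph (D :|: out_nbrs D (graph W f)) (glue D f id).
Proof.
congr pair; apply/setP => -[x y]; rewrite /glue !inE /=; case: ifP => xD.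
  by rewrite andbT.
by rewrite andbF eq_sym andbN.
Qed.

Lemma eq_out_restr_graph W W' f g D : {in D, f =1 g} ->
  out_restr (graph W f) D = out_restr (graph W' g) D.
Proof.
move=> fg; rewrite !out_restr_graph.
have -> : out_nbrs D (graph W f) = out_nbrs D (graph W' g).
  by apply/setP => x; rewrite !out_nbrs_graph (eq_in_imset fg).
by apply: eq_graph => x; rewrite /glue; case: ifP => // /fg.
Qed.

Lemma weight_out_restr W f D :
  weight v (out_restr (graph W f) D) = cost_on arc_cost D f.
Proof.
rewrite out_restr_graph weight_graph cost_glue [X in (_ + X)%R]big1 ?addr0 // => x _.
by rewrite /arc_cost eqxx.
Qed.

(** All paths from [D] leave through [x], so [f x] is the only root of the restriction and [x] the
    only root of the graph induced on [D]. *)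
Lemma out_restr_out_trees f D x : forest_in (arc V) f -> x \in D -> f x \notin D ->
  roots_in D f = set0 -> {in D, forall y, f y \notin D -> y = x} ->
  out_restr (graph [set: T] f) D \in out_trees V D.
Proof.
move=> [acf fV] xD fxD D0 exitx; rewrite out_restr_graph.
have -> : out_nbrs D (graph [set: T] f) = [set f x].
  apply/setP => z; rewrite out_nbrs_graph inE; apply/andP/eqP => [[zD]|->].
    by case/imsetP => y yD ey; rewrite ey (exitx y) // -ey.
  by rewrite fxD imset_f.
set W := D :|: [set f x]; set e := glue D f id.
have eD y : y \in D -> e y = f y by apply: glue_in.
have fD y : y \in D -> f y != y.
  by move=> yD; apply/negP => fy; move/setP/(_ y): D0; rewrite inE yD fy inE.
have eC y : y \notin D -> e y = y by apply: glue_out.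
have DW : D \subset W by apply: subsetUl.
have ace : acyc e by apply: acyc_glueC.
have eV y : e y = y \/ arc V y (e y).
  by rewrite /e /glue; case: ifP; [case: (fV y); [left|right]|left].
have wfe : wf_digraph (graph W e).
  apply/wf_graphP => y; have [yD|/eC //] := boolP (y \in D).
  rewrite (subsetP DW) // eD // => _; split=> //; rewrite !inE.
  by have [//|/exitx ->] := boolP (f y \in D); rewrite ?eqxx ?orbT.
set e' := glue [set y in D | e y \in D] e id.
have ace' : acyc e' by apply: acyc_glueC.
have wfe' : wf_digraph (graph D e').
  by apply/wf_graphP => y; rewrite /e' /glue inE; case: ifP => // /andP[].
have e'V y : e' y = y \/ arc V y (e' y).
  by rewrite /e' /glue; case: ifP; [case: (eV y); [left|right]|left].
rewrite inE; apply/and5P; split.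
- exact/subgraph_graph.
- apply/is_tree_graph => //; split=> //; apply/eqP/cards1P; exists (f x).
  apply/setP => y; rewrite !inE; have [yD|yD] /= := boolP (y \in D).
    by rewrite eD // (negPf (fD _ yD)); apply/esym/eqP => ey; rewrite -ey yD in fxD.
  by rewrite eC // eqxx andbT.
- by rewrite /= /W setUC cardsU1 fxD.
- exact: DW.
apply/andP; split; last first.
  apply/pred0P => y /=; rewrite inE outdeg_graph; apply/negP => /andP[/andP[_ ey] yD].
  by move: ey; rewrite eD // (negPf (fD _ yD)).
rewrite induced_graph // inE; apply/and3P; split=> //; first exact/subgraph_graph.
apply/is_tree_graph => //; split=> //; apply/eqP/cards1P; exists x.
apply/setP => y; rewrite !inE /e' /glue inE; have [yD|yD] /= := boolP (y \in D); last first.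
  by apply/esym/eqP => yx; rewrite yx xD in yD.
rewrite eD //; have [fyD|fyD] := boolP (f y \in D).
  by rewrite (negPf (fD _ yD)); apply/esym/eqP => yx; rewrite -yx fyD in fxD.
by rewrite eqxx (exitx y) ?eqxx.
Qed.

(** The map encoding [S] fixes every vertex outside [D], so it is also a spanning forest of [V],
    from which [S] is recovered by restriction. *)
Lemma out_trees_fun S D : D != set0 -> S \in out_trees V D ->
  exists s, [/\ S = out_restr (graph [set: T] s) D, forest_in (arc V) s &
    roots_in D s = set0].
Proof.
move=> /set0Pn[z zD]; rewrite inE => /and5P[sSV /andP[FS _] cardS DS /andP[_ rootD]].
have := graph_fun_of FS; set s := fun_of S; set W := verts S in cardS DS * => eS.
move: sSV rootD FS; rewrite -eS => /subgraph_graph[wf sV] rootD /is_forest_graph acs.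
move: cardS DS => cardW DW.
have sD y : y \in D -> s y != y.
  move=> yD; apply/negP => sy; move/pred0P/(_ y): rootD; rewrite /= yD andbT.
  by rewrite inE outdeg_graph sy (subsetP DW).
have /cards1P[w Ww] : #|W :\: D| == 1.
  rewrite cardsD (setIidPr DW); move/eqP: cardW => ->; rewrite subSn // subnn //.
have wW : (w \in W) && (w \notin D).
  by rewrite andbC -in_setD Ww set11.
have uniq_w y : y \in W -> y \notin D -> y = w.
  by move=> yW yD; apply/eqP; rewrite -in_set1 -Ww inE yD.
have [wW' wD] := andP wW.
(* The vertex [w] is the root of [S], since paths in [W] end at a root and [D] contains none. *)
have sC y : y \notin D -> s y = y.
  move=> yD; apply: contrapT => sy; have [yW _] := (wf_graphP _ _ wf) y sy.
  have ew := uniq_w y yW yD.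
  have rW : rt s y \in W by apply: rt_closed => //; apply: wf_graph_closed.
  have rD : rt s y \notin D by apply/negP => /sD/eqP; apply; apply: acs.
  by apply: sy; rewrite ew -{2}(uniq_w _ rW rD) -acs (uniq_w _ rW rD).
exists s; split; last first.
- by apply/setP => y; rewrite !inE; case: (boolP (y \in D)) => //= /sD/negPf.
- by split.
rewrite out_restr_graph.
have -> : D :|: out_nbrs D (graph setT s) = W.
  apply/setP => y; rewrite in_setU out_nbrs_graph.
  apply/orP/idP => [[/(subsetP DW) //|]|yW].
    by case/andP => _ /imsetP[a aD ->]; apply: wf_graph_closed => //; apply: (subsetP DW).
  have [yD|yD] := boolP (y \in D); [by left|right]; rewrite /= (uniq_w y) //.
  (* If no arc left [D], the path from [z] would end at a root in [D]. *)
  suff : ~~ [forall a in D, s a \in D].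
    rewrite negb_forall_in => /exists_inP[a aD saD].
    by rewrite -(uniq_w (s a)) ?imset_f //;
      apply: wf_graph_closed => //; apply: (subsetP DW).
  apply/negP => /forall_inP cl; have /sD/eqP := rt_closed cl zD; apply; exact: acs.
by apply: eq_graph => y; rewrite /glue; case: ifP => // /negbT/sC.
Qed.

End FunctionGraphs.

(** * The unique labeled atom left by [F] *)

Theorem theorem4 (R : realType) (T : finType) (V : digraph T)
    (v : T -> T -> R) (k : nat) (F : digraph T)
    (V_spans : verts V = [set: T]) (V_wf : wf_digraph V)
    (V_loopless : loopless V)
    (V_has_spanning_tree : trees_on V [set: T] != set0)
    (k_gt0 : 0 < k) (k_le : k <= #|T| - 1)
    (phi_gap : (phi v V (k - 1) - phi v V k > phi v V k - phi v V (k + 1))%E)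
    (F_min : F \in min_forests v V (k - 1)) :
  (exists! Z : {set T}, Z \in labeled_atoms v V k /\ out_nbrs Z F != set0) /\
  (forall Z : {set T}, Z \in labeled_atoms v V k -> out_nbrs Z F != set0 ->
     out_restr F Z \in min_out_trees v V Z /\
     (forall S : digraph T, S \in min_out_trees v V Z ->
        exists2 G : digraph T,
          G \in min_forests v V (k - 1) & out_restr G Z = S)).
Proof.
have [f eF Mf] := (min_forestsP v V_spans (k - 1) F).1 F_min.
have [g0 Mg0] := min_forest_exists V_spans phi_gap.
have gap := gap_min_forest V_spans k_gt0 phi_gap.
case: k k_gt0 k_le phi_gap F_min Mf Mg0 gap => // m _ _ _ _.
rewrite subn1 addn1 /= => Mf Mg0 gap.
have [q [[h Mh hq] fq closed]] := unrooted_atom gap Mf Mg0.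
have acf : acyc f by case: Mf => -[].
have atom_q Z : Z \in labeled_atoms v V m.+1 -> out_nbrs Z F != set0 ->
    forall x, x \in Z <-> sim (arc V) (arc_cost v) m x q.
  move=> /(labeled_atomsP _ V_spans)[f' [p [Mf' fp ZP]]].
  rewrite eF => /out_nbrs_graphP[x /ZP xp fx].
  have pq : sim (arc V) (arc_cost v) m p q.
    by apply: contrapT => pq; move/negP: fx; apply; apply/ZP; apply: (closed f').
  by move=> y; rewrite ZP; split=> H g Mg; rewrite H // pq.
split.
  exists [set x | `[< sim (arc V) (arc_cost v) m x q >]].
  set Z := [set x | _].
  have ZP x : x \in Z <-> sim (arc V) (arc_cost v) m x q.
    by rewrite inE; split=> /asboolP.
  split=> [|Z' [LZ' outZ']]; last first.
    apply/setP => x; have := ZP x; have := atom_q _ LZ' outZ' x.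
    by move=> e1 e2; apply/idP/idP; [move/e2/e1|move/e1/e2].
  split; first by apply/(labeled_atomsP _ V_spans); exists h, q.
  (* If [f] did not leave [Z], its path from [q] would end at a root in [Z]. *)
  rewrite eF; apply/out_nbrs_graphP; apply: contrapT => noexit.
  have /ZP/fq : rt f q \in Z.
    apply: rt_closed; last by apply/ZP.
    by move=> x xZ; apply: contraT => fx; case: noexit; exists x.
  by apply; apply: acf.
move=> Z LZ outZ; have ZP := atom_q _ LZ outZ.
have [g [Mg gZ Mfg uniq]] := unique_exit gap Mf Mh hq fq.
have eZ : Z = tree_of g q by apply/setP => x; apply/idP/idP => [/ZP/gZ|/gZ/ZP].
rewrite -eZ in Mfg uniq.
have acg : acyc g by case: Mg => -[].
have Ff : forest_in (arc V) f by case: Mf.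
have Z0 : roots_in Z f = set0.
  apply/setP => x; rewrite inE in_set0; apply/negP => /andP[/ZP/fq fx /eqP //].
have glued s : forest_in (arc V) s -> forest_in (arc V) (glue Z s g).
  move=> Fs; apply: forest_in_glue => //; first by case: Mg.
  by apply: acyc_glueC => //; [case: Fs|rewrite eZ; apply: tree_ofC_closed].
have ZN0 : Z != set0 by apply/set0Pn; exists q; apply/ZP.
have reglue s : forest_in (arc V) s -> roots_in Z s = set0 ->
    (cost_on (arc_cost v) Z f <= cost_on (arc_cost v) Z s)%R /\
    (cost_on (arc_cost v) Z s = cost_on (arc_cost v) Z f ->
     min_forest (arc V) (arc_cost v) m (glue Z s g)).
  by move=> Fs s0; apply: min_forest_reglue => //; [apply: glued|rewrite s0 Z0].
have out_F : out_restr F Z \in out_trees V Z.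
  move: outZ; rewrite eF => /out_nbrs_graphP[x xZ fx].
  by apply: (out_restr_out_trees V_spans Ff xZ fx Z0) => y yZ fy; apply: uniq.
split.
  apply/minimizersP; split=> // S /(out_trees_fun V_spans ZN0)[s [-> Fs s0]].
  by rewrite eF !weight_out_restr; have [] := reglue s Fs s0.
move=> S /minimizersP[/(out_trees_fun V_spans ZN0)[s [-> Fs s0]] minS].
have [le_s min_s] := reglue s Fs s0.
(* On [Z] the map [s] costs as much as [f], both restrictions being minimal, so replacing [f] by [s]
   in [glue Z f g] keeps that forest minimal. *)
exists (graph [set: T] (glue Z s g)).
  apply/(min_forestsP _ V_spans); exists (glue Z s g) => //; apply: min_s.
  have := minS _ out_F; rewrite eF !weight_out_restr => ge_s.
  by apply/eqP; rewrite eq_le le_s ge_s.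
by apply: eq_out_restr_graph => x /glue_in->.
Qed.
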